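(* Let $\mathcal{H}$ be a linear $r$-partite $r$-uniform hypergraph (with a fixed partition into parts $V_1,\dots,V_r$). Then $\mathcal{H}$ is $\mathcal{G}_r(3r-3,3)$-free if and only if it contains no rainbow 3-cycles.
   Context: A hypergraph is linear if any two distinct edges share at most one vertex. An $r$-uniform hypergraph is $r$-partite if its vertex set is partitioned into $r$ parts $V_1,\dots,V_r$ such that every edge contains exactly one vertex of each part. A cycle of length $k$ is a sequence $v_1,A_1,\dots,v_k,A_k,v_1$ with distinct vertices $v_i$, distinct edges $A_i$, $v_i,v_{i+1}\in A_i$ for $1\le i\le k-1$ and $v_k,v_1\in A_k$; it is a rainbow $k$-cycle if $v_1,\dots,v_k$ lie in pairwise different parts. An $r$-uniform hypergraph is $\mathcal{G}_r(v,e)$-free if the union of any $e$ distinct edges has at least $v+1$ vertices. *)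

(* Defs.v *)
From mathcomp Require Import all_boot.

Set Implicit Arguments.
Unset Strict Implicit.
Unset Printing Implicit Defensive.

(* A hypergraph is given by its finite vertex type T and its edge set
   H : {set {set T}}; there are no repeated edges. *)

Definition uniform (T : finType) (r : nat) (H : {set {set T}}) : Prop :=
  forall A, A \in H -> #|A| = r.

Definition linear (T : finType) (H : {set {set T}}) : Prop :=
  forall A B, A \in H -> B \in H -> A != B -> #|A :&: B| <= 1.

(* The parts are indexed by 'I_r, and a part is allowed to be empty (which can
   only happen when H has no edge). *)
Definition partite (T : finType) (r : nat) (V : 'I_r -> {set T})
    (H : {set {set T}}) : Prop :=
  [/\ \bigcup_i V i = [set: T],
      forall i j, i != j -> [disjoint V i & V j] &
      forall A, A \in H -> forall i, #|A :&: V i| = 1].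

(* Indices start at 0 and [ordS] is the cyclic successor on 'I_k, so the last
   edge contains the last and the first vertex. *)
Definition is_cycle (T : finType) (H : {set {set T}}) (k : nat)
    (v : 'I_k -> T) (A : 'I_k -> {set T}) : Prop :=
  [/\ injective v, injective A, forall i, A i \in H &
      forall i, v i \in A i /\ v (ordS i) \in A i].

Definition rainbow (T : finType) (r : nat) (V : 'I_r -> {set T}) (k : nat)
    (v : 'I_k -> T) : Prop :=
  forall i j, i != j -> forall p, ~ (v i \in V p /\ v j \in V p).

Definition has_rainbow_cycle (T : finType) (r : nat) (V : 'I_r -> {set T})
    (H : {set {set T}}) (k : nat) : Prop :=
  exists (v : 'I_k -> T) (A : 'I_k -> {set T}),
    is_cycle H v A /\ rainbow V v.

(* Applied to an r-uniform H, this is G_r(n, e)-freeness. *)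
Definition G_free (T : finType) (n e : nat) (H : {set {set T}}) : Prop :=
  forall S : {set {set T}}, S \subset H -> #|S| = e ->
    n + 1 <= #|\bigcup_(A in S) A|.

(* Main.v *)
Require Import Defs.
From mathcomp Require Import all_boot.
From mathcomp Require Import zify.

(** By inclusion-exclusion, three distinct edges of size r meeting pairwise in
    at most one vertex span at most 3r - 3 vertices exactly when they meet
    pairwise but have no common vertex, i.e. when they form a 3-cycle. In an
    r-partite hypergraph every 3-cycle is rainbow, because any two of its
    vertices lie in a common edge and an edge meets each part only once. *)

(** Inclusion-exclusion in additive form, free of truncated subtraction. The pairs are listed
    cyclically so as to match [A i :&: A (ordS i)]. *)
Lemma cardsU3 (T : finType) (A B C : {set T}) :
  #|A :|: B :|: C| + (#|A :&: B| + #|B :&: C| + #|C :&: A|) =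
  #|A| + #|B| + #|C| + #|A :&: B :&: C|.
Proof.
have := cardsUI (A :|: B) C; have := cardsUI A B.
have := cardsUI (A :&: C) (B :&: C).
rewrite setIUl -setIIl (setIC C A); lia.
Qed.

Lemma ordS3 : (ordS (inord 0 : 'I_3) = inord 1) *
  (ordS (inord 1 : 'I_3) = inord 2) * (ordS (inord 2 : 'I_3) = inord 0).
Proof. by do ![split]; apply/val_inj; rewrite /= !inordK. Qed.

Lemma forall_ord3 (P : 'I_3 -> Prop) :
  P (inord 0) -> P (inord 1) -> P (inord 2) -> forall i, P i.
Proof.
move=> P0 P1 P2 i; rewrite -(inord_val i).
by case: i => [[|[|[|]]]].
Qed.

(** Reduces conditions on all pairs of indices to conditions on cyclically consecutive ones. *)
Lemma ord3_cases (i j : 'I_3) : i != j -> j = ordS i \/ i = ordS j.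
Proof.
case: i j => [[|[|[|//]]] ?] [[|[|[|//]]] ?] //= _.
all: by [left; apply/val_inj | right; apply/val_inj].
Qed.

Lemma bigcup_ord3 (T : finType) (A : 'I_3 -> {set T}) :
  \bigcup_i A i = A (inord 0) :|: A (inord 1) :|: A (inord 2).
Proof.
rewrite !big_ord_recl big_ord0 setU0 setUA.
by congr (A _ :|: A _ :|: A _); apply/val_inj; rewrite /= inordK.
Qed.

Section ThreeEdges.

Variables (T : finType) (r : nat) (H : {set {set T}}).
Hypotheses (unifH : uniform r H) (linH : linear H).
Variable A : 'I_3 -> {set T}.
Hypotheses (injA : injective A) (AH : forall i, A i \in H).

(** Distinct edges cannot all be empty. Hence the truncated [3 * r - 3] is the true difference. *)
Lemma rank_gt0 : 0 < r.
Proof.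
rewrite lt0n; apply/eqP => r0.
have A0 i : A i = set0 by apply/eqP; rewrite -cards_eq0 unifH ?r0.
have /injA/(congr1 val) : A (inord 0) = A (inord 1) by rewrite !A0.
by rewrite /= !inordK.
Qed.

Lemma card_meet_succ i : #|A i :&: A (ordS i)| <= 1.
Proof.
apply: linH => //; apply/negP => /eqP/injA; apply/eqP; move: i.
by apply: forall_ord3; rewrite !ordS3 -val_eqE /= !inordK.
Qed.

(** The union has 3r - s + t vertices, with s the sum of the three pairwise intersection sizes and t
    the size of the triple one. Linearity gives s <= 3, so s - t >= 3 forces every pairwise size to
    be 1 and t = 0. *)
Lemma card_union_le : #|\bigcup_i A i| <= 3 * r - 3 <->
  (forall i, A i :&: A (ordS i) != set0) /\
  A (inord 0) :&: A (inord 1) :&: A (inord 2) = set0.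
Proof.
have := cardsU3 T (A (inord 0)) (A (inord 1)) (A (inord 2)).
have := card_meet_succ (inord 0); have := card_meet_succ (inord 1).
have := card_meet_succ (inord 2).
rewrite bigcup_ord3 !ordS3 !(unifH _ (AH _)) => le2 le1 le0 cardU.
have r0 := rank_gt0.
split=> [leU | [meet I0]].
  split; last by apply/eqP; rewrite -cards_eq0; lia.
  by apply: forall_ord3; rewrite !ordS3 -card_gt0; lia.
have := meet (inord 0); have := meet (inord 1); have := meet (inord 2).
rewrite !ordS3 -!card_gt0; move: cardU; rewrite I0 cards0; lia.
Qed.

Lemma card_union_cycle :
  #|\bigcup_i A i| <= 3 * r - 3 <-> exists v, is_cycle H v A.
Proof.
rewrite card_union_le; split=> [[meet I0] | [v [injv _ _ vA]]].
  (* The vertex [v i] joins the edge before it to the edge [A i]. *)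
  have /fin_all_exists[v vA] i : exists x, x \in A (ord_pred i) :&: A i.
    by apply/set0Pn; rewrite -{2}(ord_predK i) meet.
  have vA' i : v i \in A i /\ v (ordS i) \in A i.
    have /setIP[_ vi] := vA i.
    by have := vA (ordS i); rewrite ordSK => /setIP[].
  exists v; split=> //.
  (* If two consecutive vertices coincided, that vertex would lie in all three edges. *)
  have vS i : v i != v (ordS i).
    apply/eqP; move: i; have no x : x \in A (inord 0) -> x \in A (inord 1) ->
        x \in A (inord 2) -> False.
      by move=> x0 x1 x2; have := in_set0 x; rewrite -I0 !inE x0 x1 x2.
    have := vA' (inord 0); have := vA' (inord 1); have := vA' (inord 2).
    rewrite !ordS3 => -[v22 v02] [v11 v21] [v00 v10].
    apply: forall_ord3; rewrite !ordS3 => e.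
    - by apply: (no (v (inord 0))) => //; rewrite e.
    - by apply: (no (v (inord 1))) => //; rewrite e.
    - by apply: (no (v (inord 2))) => //; rewrite e.
  move=> i j eqv; apply/eqP/negPn/negP => /ord3_cases[] e.
    by have := vS i; rewrite -e eqv eqxx.
  by have := vS j; rewrite -e eqv eqxx.
split.
  by move=> i; apply/set0Pn; exists (v (ordS i));
     rewrite !inE (vA i).2 (vA (ordS i)).1.
(* By linearity, a common vertex [x] would equal both [v (inord 1)] and [v (inord 2)], the shared
   vertices of two pairs of edges. *)
apply/eqP/set0Pn => -[x /setIP[/setIP[x0 x1] x2]].
have := vA (inord 0); have := vA (inord 1); have := vA (inord 2).
rewrite !ordS3 => -[v22 v02] [v11 v21] [v00 v10].
have eqx i y : x \in A i :&: A (ordS i) -> y \in A i :&: A (ordS i) -> x = y.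
  by move=> xi yi; apply: (card_le1_eqP (card_meet_succ i)).
have e1 : x = v (inord 1).
  by apply: (eqx (inord 0)); rewrite ordS3 inE ?x0 ?v10.
have e2 : x = v (inord 2).
  by apply: (eqx (inord 1)); rewrite ordS3 inE ?x1 ?v21.
have /injv/(congr1 val) : v (inord 1) = v (inord 2) by rewrite -e1.
by rewrite /= !inordK.
Qed.

End ThreeEdges.

Lemma three_cycle_rainbow (T : finType) (r : nat) (V : 'I_r -> {set T})
    (H : {set {set T}}) (v : 'I_3 -> T) (A : 'I_3 -> {set T}) :
  partite V H -> is_cycle H v A -> rainbow V v.
Proof.
move=> [_ _ AV] [injv _ AH vA].
have vS i p : v i \in V p -> v (ordS i) \in V p -> v i = v (ordS i).
  move=> vi vSi; have /eqP := AV _ (AH i) p; case/cards1P => x Ax.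
  have [viA vSA] := vA i.
  have /set1P-> : v i \in [set x] by rewrite -Ax inE viA.
  by have /set1P-> : v (ordS i) \in [set x] by rewrite -Ax inE vSA.
(* The indices are consecutive in one order or the other, so [vS] contradicts injectivity of [v]. *)
move=> i j neq p [vi vj]; move: (neq); case/ord3_cases: (neq) => e.
  by rewrite (injv i j) ?eqxx // e; apply: vS vi _; rewrite -e.
by rewrite (injv i j) ?eqxx // e; apply/esym; apply: vS vj _; rewrite -e.
Qed.

Theorem theorem8 (T : finType) (r : nat) (V : 'I_r -> {set T})
    (H : {set {set T}}) (Huniform : uniform r H) (Hpartite : partite V H)
    (Hlinear : linear H) :
  G_free (3 * r - 3) 3 H <-> ~ has_rainbow_cycle V H 3.
Proof.
split=> [free [v [A [cycA _]]] | norainbow S SH cardS].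
  have [_ injA AH _] := cycA.
  have : #|\bigcup_i A i| <= 3 * r - 3.
    by apply/(card_union_cycle _ _ _ Huniform Hlinear) => //; exists v.
  (* Freeness is applied to the set of the three edges of the cycle. *)
  have /free : A @: setT \subset H by apply/subsetP => _ /imsetP[i _ ->].
  rewrite card_imset // cardsT card_ord big_imset /=; last by move=> ? ? _ _ /injA.
  by under eq_bigl do rewrite inE; move=> /(_ erefl); rewrite addn1 ltnNge => /negP.
(* Conversely, a violating [S] is enumerated by ['I_3], and its small union yields a cycle. *)
pose A (i : 'I_3) := enum_val (cast_ord (esym cardS) i).
have injA : injective A by move=> i j /enum_val_inj/cast_ord_inj.
have AS i : A i \in S by apply: enum_valP.
have imA : S = A @: setT.
  apply/esym/eqP; rewrite eqEcard card_imset // cardsT card_ord cardS leqnn andbT.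
  by apply/subsetP => _ /imsetP[i _ ->].
have AH i : A i \in H by apply: (subsetP SH).
rewrite addn1 ltnNge; apply/negP => leU; apply: norainbow.
have [|v cycA] := (card_union_cycle _ _ _ Huniform Hlinear A injA AH).1.
  move: leU; rewrite {1}imA big_imset /=; last by move=> ? ? _ _ /injA.
  by under eq_bigl do rewrite inE.
by exists v, A; split=> //; apply: three_cycle_rainbow cycA.
Qed.
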